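(* For every finite $A$-generated group $Q$ and every positive integer $n$ there exists a finite $A$-generated group $H$ expanding $Q$ such that the following holds. For every finite connected graph $\mathcal{E}$ on at most $n$ vertices and every word labelling $v\colon \mathrm{K}(\mathcal{E})\to\tilde A^*$ that commutes over $H$ there exists a word labelling $w\colon\mathrm{K}(\mathcal{E})\to\tilde A^*$ that commutes over the free group $F$ and such that for every edge $k$ of $\mathcal{E}$ (1) $[v(k)]_Q=[w(k)]_Q$ and (2) $\mathrm{co}(\pi_1^{\mathcal{Q}}(v(k)))\supseteq\mathrm{co}(\pi_1^{\mathcal{Q}}(w(k)))$.
   Context: $A$ is a finite non-empty set, $\tilde A=A\cup A^{-1}$ with $A^{-1}$ a disjoint copy of formal inverses, $\tilde A^*$ the set of words over $\tilde A$ with involution $(x_1\cdots x_n)^{-1}=x_n^{-1}\cdots x_1^{-1}$, $F$ the free group on $A$. An $A$-generated group is a group $G$ with a (not necessarily injective) map $A\to G$ whose image generates $G$; $[w]_G$ is the value of $w\in\tilde A^*$ in $G$. $H$ expands $Q$ if there is a homomorphism $H\to Q$ respecting the generators from $A$. Graphs $\mathcal{E}=(V\cup K;\alpha,\omega,{}^{-1})$ have edge set $K=\mathrm{K}(\mathcal{E})$, initial/terminal vertex maps $\alpha,\omega\colon K\to V$ and an involution on $K$ with $\alpha e=\omega e^{-1}$, $\omega e=\alpha e^{-1}$, $e\ne e^{-1}$ (loops and multiple edges allowed). A word labelling is a map $v\colon K\to\tilde A^*$ with $v(e^{-1})=v(e)^{-1}$; it commutes over an $A$-generated group $G$ if $[v(e_1)\cdots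 v(e_m)]_G=1_G$ for every closed path $e_1\cdots e_m$. The Cayley graph $\mathcal{Q}$ of $Q$ has vertex set $Q$ and edges $(q,a)\in Q\times\tilde A$ from $q$ to $q[a]_Q$, with $(q,a)^{-1}=(q[a]_Q,a^{-1})$; its positive edges are the elements of $E=Q\times A$. For $x\in\tilde A^*$, $\pi_1^{\mathcal{Q}}(x)$ is the path in $\mathcal{Q}$ starting at $1_Q$ with label $x$, considered as a word over $Q\times\tilde A=E\cup E^{-1}$. Its content $\mathrm{co}(\pi_1^{\mathcal{Q}}(x))$ is the set of all $e\in E$ such that $e$ or $e^{-1}$ occurs in this word. *)

(* Defs.v *)
From HB Require Import structures.
From mathcomp Require Import all_boot all_fingroup.

Set Implicit Arguments.
Unset Strict Implicit.
Unset Printing Implicit Defensive.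

Import GroupScope.
Local Open Scope group_scope.

(* [inl a] is the generator a, [inr a] its formal inverse. *)
Definition letter (A : finType) : finType := (A + A)%type.

Definition letter_inv (A : finType) (x : letter A) : letter A :=
  match x with inl a => inr a | inr a => inl a end.

Definition word (A : finType) := seq (letter A).

Definition word_inv (A : finType) (w : word A) : word A :=
  rev (map (@letter_inv A) w).

Definition letter_val (A : finType) (G : groupType) (f : A -> G)
    (x : letter A) : G :=
  match x with inl a => f a | inr a => (f a)^-1 end.

(* The value [w]_G of the word w, where f maps A to G. *)
Definition word_val (A : finType) (G : groupType) (f : A -> G)
    (w : word A) : G :=
  \prod_(x <- w) letter_val f x.

(* The finite group G is A-generated via f, which need not be injective. *)
Definition generates (A : finType) (G : finGroupType) (f : A -> G) : Prop :=
  <<f @: [set: A]>> = [set: G].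

Definition expands (A : finType) (H : finGroupType) (h : A -> H)
    (Q : finGroupType) (q : A -> Q) : Prop :=
  exists phi : {morphism [set: H] >-> Q}, forall a, phi (h a) = q a.

Lemma letter_invK (A : finType) : involutive (@letter_inv A).
Proof. by case. Qed.

Lemma letter_inv_neq (A : finType) (x : letter A) : letter_inv x <> x.
Proof. by case: x. Qed.

(* The free group on A: freely reduced words, multiplied by concatenating and *)
(* then cancelling; [push x w] is the reduced form of x w for w reduced.      *)
Section FreeGroup.
Variable A : finType.
Implicit Types (x y : letter A) (u v w : word A).

Definition reduced w := sorted (fun x y => y != letter_inv x) w.

Definition push x w : word A :=
  if w is y :: w' then if y == letter_inv x then w' else x :: w else [:: x].

Definition pushes u w : word A := foldr push w u.

Lemma push_reduced x w : reduced w -> reduced (push x w).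
Proof.
case: w => //= y w; case: ifPn => [_ /path_sorted //|yx rw].
by rewrite /reduced /= yx.
Qed.

Lemma pushes_reduced u w : reduced w -> reduced (pushes u w).
Proof. by move=> rw; elim: u => //= x u; apply: push_reduced. Qed.

Lemma push_cons x w : reduced (x :: w) -> push x w = x :: w.
Proof. by case: w => //= y w /andP[/negPf->]. Qed.

Lemma pushes0 w : reduced w -> pushes w [::] = w.
Proof.
elim: w => //= x w IHw rxw; rewrite IHw ?push_cons //.
exact: path_sorted rxw.
Qed.

Lemma pushK x w : reduced w -> push x (push (letter_inv x) w) = w.
Proof.
case: w => [|y w] rw /=; first by rewrite eqxx.
rewrite letter_invK; case: eqP => [yx|_] /=; last by rewrite eqxx.
by rewrite -yx push_cons.
Qed.

Lemma pushes_push x u w :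
  reduced u -> reduced w -> pushes (push x u) w = push x (pushes u w).
Proof.
case: u => //= y u _ rw; case: eqP => //= ->.
by rewrite pushK // pushes_reduced.
Qed.

Lemma pushesA u v w : reduced v -> reduced w ->
  pushes u (pushes v w) = pushes (pushes u v) w.
Proof.
move=> rv rw; elim: u => //= x u ->.
by rewrite pushes_push // pushes_reduced.
Qed.

Lemma word_invK : involutive (@word_inv A).
Proof.
by move=> w; rewrite /word_inv map_rev revK mapK //; apply: letter_invK.
Qed.

Lemma word_inv_reduced w : reduced w -> reduced (word_inv w).
Proof.
rewrite /reduced /word_inv rev_sorted sorted_map; apply: sub_sorted => x y /=.
by apply: contraNneq => ->; rewrite letter_invK.
Qed.

Lemma pushes_invl u v :
  reduced v -> pushes (word_inv u) (pushes u v) = v.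
Proof.
elim: u v => //= x u IHu v rv; rewrite /word_inv /= rev_cons /pushes.
rewrite foldr_rcons -/(pushes u v) -{2}[x]letter_invK pushK ?pushes_reduced //.
exact: IHu.
Qed.

Lemma pushes_invr w : reduced w -> pushes w (word_inv w) = [::].
Proof.
move=> rw; have rw' := word_inv_reduced rw.
by have := pushes_invl (word_inv w) (isT : reduced [::]);
  rewrite word_invK pushes0.
Qed.

Record free_group := FreeGroup {
  free_word : word A;
  free_word_reduced : reduced free_word
}.

HB.instance Definition _ := [isSub for free_word].
HB.instance Definition _ := [Choice of free_group by <:].

Implicit Types g h : free_group.

Definition free_one : free_group := @FreeGroup [::] isT.
Definition free_mul g h : free_group :=
  FreeGroup (pushes_reduced (free_word g) (free_word_reduced h)).
Definition free_inv g : free_group :=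
  FreeGroup (word_inv_reduced (free_word_reduced g)).

Fact free_mulA : associative free_mul.
Proof.
by move=> f g h; apply/val_inj; rewrite /= pushesA ?free_word_reduced.
Qed.

Fact free_mul1g : left_id free_one free_mul.
Proof. by move=> g; apply/val_inj. Qed.

Fact free_mulg1 : right_id free_one free_mul.
Proof. by move=> g; apply/val_inj; rewrite /= pushes0 ?free_word_reduced. Qed.

Fact free_mulVg : left_inverse free_one free_inv free_mul.
Proof.
move=> g; apply/val_inj => /=.
have := pushes_invl (free_word g) (isT : reduced [::]).
by rewrite pushes0 ?free_word_reduced.
Qed.

Fact free_mulgV : right_inverse free_one free_inv free_mul.
Proof.
by move=> g; apply/val_inj; rewrite /= pushes_invr ?free_word_reduced.
Qed.

HB.instance Definition _ := isGroup.Build free_group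
  free_mulA free_mul1g free_mulg1 free_mulVg free_mulgV.

Definition free_gen (a : A) : free_group := @FreeGroup [:: inl a] isT.

Lemma free_gen_generates g : word_val free_gen (free_word g) = g.
Proof.
suff E w : free_word (word_val free_gen w) = pushes w [::].
  by apply/val_inj; rewrite /= E pushes0 ?free_word_reduced.
rewrite /word_val; elim: w => [|x w IHw]; first by rewrite big_nil.
by rewrite big_cons /= -IHw; case: x.
Qed.

Lemma free_group_universal (G : groupType) (f : A -> G) :
  exists phi : free_group -> G,
    (forall g h, phi (g * h) = phi g * phi h) /\
    (forall a, phi (free_gen a) = f a).
Proof.
exists (fun g => word_val f (free_word g)); split; last first.
  by move=> a; rewrite /word_val /= big_seq1.
have E x w : word_val f (push x w) = letter_val f x * word_val f w.
  rewrite /word_val; case: w => [|y w] /=; first by rewrite big_seq1 big_nil mulg1.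
  case: eqP => [->|_]; last by rewrite big_cons.
  by rewrite big_cons mulgA; case: x => a /=; rewrite ?mulgV ?mulVg mul1g.
move=> g h /=; elim: (free_word g) => [|x w IHw] /=.
  by rewrite /word_val big_nil mul1g.
by rewrite E IHw mulgA /word_val big_cons.
Qed.

End FreeGroup.

(* A finite graph; loops and multiple edges are allowed. *)
Record graph := Graph {
  vertex : finType;
  edge : finType;
  src : edge -> vertex;
  tgt : edge -> vertex;
  edge_inv : edge -> edge;
  edge_invK : involutive edge_inv;
  src_edge_inv : forall e, src (edge_inv e) = tgt e;
  tgt_edge_inv : forall e, tgt (edge_inv e) = src e;
  edge_inv_neq : forall e, edge_inv e <> e
}.

(* [is_path u p v]: p is a path from u to v; the empty path has u = v. *)
Fixpoint is_path (E : graph) (u : vertex E) (p : seq (edge E))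
    (v : vertex E) : Prop :=
  match p with
  | [::] => u = v
  | e :: p' => src e = u /\ is_path (tgt e) p' v
  end.

Definition connected (E : graph) : Prop :=
  forall u v : vertex E, exists p, is_path u p v.

Definition word_labelling (A : finType) (E : graph)
    (l : edge E -> word A) : Prop :=
  forall e, l (edge_inv e) = word_inv (l e).

Definition commutes_over (A : finType) (G : groupType) (f : A -> G)
    (E : graph) (l : edge E -> word A) : Prop :=
  forall (u : vertex E) (p : seq (edge E)),
    is_path u p u -> word_val f (flatten (map l p)) = 1.

Section Cayley.
Variables (A : finType) (Q : finGroupType) (q : A -> Q).

Definition cayley_edge : finType := (Q * letter A)%type.

Definition cayley_src (e : cayley_edge) : Q := e.1.

Definition cayley_tgt (e : cayley_edge) : Q := e.1 * letter_val q e.2.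

Definition cayley_inv (e : cayley_edge) : cayley_edge :=
  (cayley_tgt e, letter_inv e.2).

Fact cayley_tgt_inv e : cayley_tgt (cayley_inv e) = cayley_src e.
Proof.
by case: e => g [] a; rewrite /cayley_tgt /= ?mulgK ?mulgKV.
Qed.

Fact cayley_invK : involutive cayley_inv.
Proof.
move=> e; rewrite {1}/cayley_inv cayley_tgt_inv /= letter_invK.
by case: e.
Qed.

Fact cayley_inv_neq e : cayley_inv e <> e.
Proof. by case: e => g x [_]; apply: letter_inv_neq. Qed.

Definition cayley_graph : graph :=
  @Graph Q cayley_edge cayley_src cayley_tgt cayley_inv cayley_invK
    (fun=> erefl) cayley_tgt_inv cayley_inv_neq.

Fixpoint cayley_path_from (g : vertex cayley_graph) (x : word A) :
    seq (edge cayley_graph) :=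
  if x is a :: x' then
    let e : edge cayley_graph := (g, a) in e :: cayley_path_from (tgt e) x'
  else [::].

Definition cayley_path (x : word A) : seq (edge cayley_graph) :=
  cayley_path_from (1 : Q) x.

Definition positive_edge (e : Q * A) : edge cayley_graph := (e.1, inl e.2).

Definition content (p : seq (edge cayley_graph)) : {set Q * A} :=
  [set e | (positive_edge e \in p) || (edge_inv (positive_edge e) \in p)].

End Cayley.

(* Main.v *)
(* Replace each finite A-generated group P by the extension whose elements    *)
(* record, besides a vertex of the Cayley graph of P, how often modulo 2 each *)
(* edge has been traversed. If words u and w have the same value in this      *)
(* extension, then the edges of P that u uses an odd number of times are used *)
(* by w too, and they contain a path with the same endpoints.                 *)
(*   The labelling problem amounts to lifting a family of points g(x) of P to *)
(* the free group when certain pairs, the links, are joined by paths with     *)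
(* prescribed content. Add a hub d joined to the points. Descending one level *)
(* of the extension, walk from d towards a point of a connected component K   *)
(* of the links, through odd edges, up to the first vertex p that lies on a   *)
(* link (x, y) of K. The edges passed so far lie on no link of K, so they are *)
(* odd for every point of K and lie in the contents allowed between d and K.  *)
(* Hence p can replace d as hub of K, and the link (x, y) becomes two hub     *)
(* constraints at p. After finitely many levels no link is left, and the      *)
(* points can be lifted independently. The number of levels needed is bounded *)
(* because a link is determined by two vertices and a set of edges of Q.      *)

From HB Require Import structures.
Require Import Defs.
From mathcomp Require Import all_boot all_fingroup.

Set Implicit Arguments.
Unset Strict Implicit.
Unset Printing Implicit Defensive.

(** A labelling v that commutes over H has a potential g on the vertices ([commuting_potential]).
    Each edge k becomes a link between the g-values of its ends, allowing the edges of Q that v(k)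
    traverses from there. If F solves these links in the free group, the reduced words w(k) of F(src
    k)^-1 F(tgt k) commute, being differences of a potential, and [lifts_content] gives (1) and (2).
    Each parity cover allows one more link ([solvable_cover], resting on [linked_odd_edges] and
    [odd_edges_linked]); edges giving the same link are merged, so n, Q and A bound the height of
    the tower. *)

Section WordValue.
Local Open Scope group_scope.
Variables (A : finType) (G : groupType) (f : A -> G).
Implicit Types (x : letter A) (u w : word A).

Lemma word_val_nil : word_val f [::] = 1.
Proof. by rewrite /word_val big_nil. Qed.

Lemma word_val_cons x w : word_val f (x :: w) = letter_val f x * word_val f w.
Proof. by rewrite /word_val big_cons. Qed.

Lemma word_val_cat u w : word_val f (u ++ w) = word_val f u * word_val f w.
Proof. by rewrite /word_val big_cat. Qed.

Lemma letter_val_inv x : letter_val f (letter_inv x) = (letter_val f x)^-1.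
Proof. by case: x => a //=; rewrite invgK. Qed.

Lemma word_inv_cons x w : word_inv (x :: w) = word_inv w ++ [:: letter_inv x].
Proof. by rewrite /word_inv /= rev_cons cats1. Qed.

Lemma word_val_inv w : word_val f (word_inv w) = (word_val f w)^-1.
Proof.
elim: w => [|x w IHw]; first by rewrite word_val_nil invg1.
rewrite word_inv_cons word_val_cat IHw !word_val_cons invMg.
by rewrite letter_val_inv word_val_nil mulg1.
Qed.

End WordValue.

Section WordValueMorphism.
Local Open Scope group_scope.
Variables (A : finType) (G : groupType) (f : A -> G).
Implicit Types w : word A.

Lemma word_val_morph (K : groupType) (k : A -> K) (phi : K -> G) w :
  {morph phi : s t / s * t} -> (forall a, phi (k a) = f a) ->
  phi (word_val k w) = word_val f w.
Proof.
move=> phiM phik.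
have phi1 : phi 1 = 1.
  by apply: (mulgI (phi 1)); rewrite -phiM !mulg1.
have phiV s : phi s^-1 = (phi s)^-1.
  by apply: (mulgI (phi s)); rewrite -phiM !mulgV phi1.
elim: w => [|x w IHw]; first by rewrite !word_val_nil phi1.
by rewrite !word_val_cons phiM IHw; case: x => a /=; rewrite ?phiV phik.
Qed.

Lemma word_val_free w w' :
  word_val (@free_gen A) w = word_val (@free_gen A) w' ->
  word_val f w = word_val f w'.
Proof.
move=> eq_ww'; have [phi [phiM phif]] := free_group_universal f.
by rewrite -!(word_val_morph (phi := phi) (k := @free_gen A)) ?eq_ww'.
Qed.

End WordValueMorphism.

(** * Walks in a Cayley graph and connectivity inside an edge set *)

Section Trail.
Local Open Scope group_scope.
Variables (A : finType) (P : finGroupType) (f : A -> P).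
Implicit Types (a b c : P) (x : letter A) (u w : word A) (S : pred (P * A)).

Definition underlying a x : P * A :=
  match x with inl l => (a, l) | inr l => (a * (f l)^-1, l) end.

(** A list rather than a set, because multiplicities enter the parity count. *)
Fixpoint trail a w : seq (P * A) :=
  if w is x :: w' then underlying a x :: trail (a * letter_val f x) w'
  else [::].

Lemma trail_cat a u w :
  trail a (u ++ w) = trail a u ++ trail (a * word_val f u) w.
Proof.
elim: u a => [|x u IHu] a /=; first by rewrite word_val_nil mulg1.
by rewrite IHu word_val_cons mulgA.
Qed.

Lemma underlying_inv a x :
  underlying (a * letter_val f x) (letter_inv x) = underlying a x.
Proof. by case: x => l //=; rewrite mulgK. Qed.

Lemma trail_inv a w :
  trail (a * word_val f w) (word_inv w) = rev (trail a w).
Proof.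
elim: w a => [|x w IHw] a //=.
rewrite word_inv_cons word_val_cons mulgA trail_cat IHw rev_cons -cats1 /=.
by rewrite word_val_inv mulgK underlying_inv.
Qed.

Lemma trail_translate a b w :
  trail (a * b) w = [seq (a * e.1, e.2) | e <- trail b w].
Proof.
elim: w b => [|x w IHw] b //=; rewrite -mulgA IHw; congr cons.
by case: x => l //=; rewrite mulgA.
Qed.

Lemma mem_content a w e :
  (e \in content (cayley_path_from (q := f) a w)) = (e \in trail a w).
Proof.
pose occurs e (u : seq (edge (cayley_graph f))) :=
  (positive_edge f e \in u) || (edge_inv (positive_edge f e) \in u).
have occursE b x (u : seq (edge (cayley_graph f))) :
    occurs e ((b, x) :: u) = (e == underlying b x) || occurs e u.
  rewrite /occurs !inE orbACA; congr orb.
  case: x e => l [g l'] {occurs};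
    rewrite /positive_edge /= /cayley_inv /cayley_tgt.
    by rewrite /= !xpair_eqE /= andbF orbF.
  rewrite /= !xpair_eqE /= andbF (can2_eq (mulgK _) (mulgKV _)) [RHS]xpair_eqE.
  have -> : ((inr l' : letter A) == inr l) = (l' == l) by [].
  by case: (eqVneq l' l) => [->|_]; rewrite ?andbF ?andbT.
rewrite inE -/(occurs e _); elim: w a => [|x w IHw] a //.
by rewrite [cayley_path_from _ _]/= occursE IHw inE.
Qed.

Definition step S : rel P :=
  [rel a b | [exists x, (b == a * letter_val f x) && S (underlying a x)]].

Definition linked S : rel P := connect (step S).

Lemma linkedP S a b :
  reflect (exists2 w, b = a * word_val f w & all S (trail a w)) (linked S a b).
Proof.
apply: (iffP connectP) => [[p] | [w]].
  elim: p a => [|c p IHp] a /=.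
    by move=> _ ->; exists [::]; rewrite ?word_val_nil ?mulg1.
  case/andP=> /existsP[x /andP[/eqP-> Sx]] /IHp{}IHp /IHp[w -> Sw].
  by exists (x :: w); rewrite ?word_val_cons ?mulgA //= Sx.
elim: w a => [|x w IHw] a /=.
  by move=> -> _; exists [::]; rewrite ?word_val_nil ?mulg1.
move=> bE /andP[Sx Sw]; rewrite word_val_cons mulgA in bE.
have [p pp bp] := IHw _ bE Sw; exists (a * letter_val f x :: p) => //=.
by rewrite pp andbT; apply/existsP; exists x; rewrite eqxx.
Qed.

Lemma linked_refl S a : linked S a a.
Proof. exact: connect0. Qed.

Lemma linked_trans S : transitive (linked S).
Proof. exact: connect_trans. Qed.

Lemma linked_sym S a b : linked S a b = linked S b a.
Proof.
suff sub c d : linked S c d -> linked S d c by apply/idP/idP; apply: sub.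
case/linkedP=> w -> Sw; apply/linkedP; exists (word_inv w).
  by rewrite word_val_inv mulgK.
by rewrite trail_inv all_rev.
Qed.

Lemma linked_edge S e : S e -> linked S e.1 (e.1 * f e.2).
Proof.
case: e => c l Se; apply/linkedP; exists [:: inl l] => /=; last by rewrite Se.
by rewrite word_val_cons word_val_nil mulg1.
Qed.

Lemma linked_trail S a w e :
  all S (trail a w) -> e \in trail a w -> linked S a e.1.
Proof.
elim: w a => [|x w IHw] a //= /andP[Sx Sw]; rewrite inE => /orP[/eqP-> | we].
  case: x Sx {Sw} => l Sx /=; first exact: linked_refl.
  by have := linked_edge Sx; rewrite /= mulgKV linked_sym.
apply: linked_trans (IHw _ Sw we); apply/linkedP; exists [:: x] => /=.
  by rewrite word_val_cons word_val_nil mulg1.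
by rewrite Sx.
Qed.

(** Cut the walk at its first vertex in [hit]: each edge before the cut has an end outside [hit]. *)
Lemma first_hit (hit : pred P) a w : hit (a * word_val f w) ->
  exists u, [/\ hit (a * word_val f u), {subset trail a u <= trail a w} &
    forall e, e \in trail a u -> ~~ (hit e.1 && hit (e.1 * f e.2))].
Proof.
elim: w a => [|x w IHw] a hita.
  by exists [::].
have [hit_a | nhit_a] := boolP (hit a).
  by exists [::]; rewrite word_val_nil mulg1.
rewrite word_val_cons mulgA in hita; have [u [hu uw ue]] := IHw _ hita.
exists (x :: u); split; first by rewrite word_val_cons mulgA.
  by move=> e /=; rewrite !inE => /orP[->|/uw->] //; rewrite orbT.
move=> e /=; rewrite inE => /orP[/eqP-> | /ue //].
by case: x {hita IHw hu uw ue} => l /=; rewrite ?mulgKV (negPf nhit_a) ?andbF.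
Qed.

End Trail.

(** * The extension recording edge parities *)

Section ParityCover.
Local Open Scope group_scope.
Variables (A : finType) (P : finGroupType).

(* [(a, c)]: a vertex a of the Cayley graph of P, and the parities c of the   *)
(* numbers of times its positive edges are traversed, in either direction.    *)
Definition parity_cover : Type := (P * {ffun P * A -> bool})%type.
HB.instance Definition _ :=
  Finite.copy parity_cover (P * {ffun P * A -> bool})%type.

Implicit Types s t : parity_cover.

(** The semidirect product of the functions from P x A to F_2 with P, which acts by left translation
    of edges. *)
Definition cover_mul s t : parity_cover :=
  (s.1 * t.1, [ffun e => s.2 e (+) t.2 (s.1^-1 * e.1, e.2)]).
Definition cover_one : parity_cover := (1, [ffun=> false]).
Definition cover_inv s : parity_cover :=
  (s.1^-1, [ffun e => s.2 (s.1 * e.1, e.2)]).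

Fact cover_mulA : associative cover_mul.
Proof.
move=> r s t; congr pair; first by rewrite /= mulgA.
by apply/ffunP=> e; rewrite !ffunE /= addbA invMg mulgA.
Qed.

Fact cover_mul1 : left_id cover_one cover_mul.
Proof.
case=> a c; congr pair; first by rewrite /= mul1g.
by apply/ffunP=> -[b l]; rewrite !ffunE /= invg1 mul1g.
Qed.

Fact cover_mulV : left_inverse cover_one cover_inv cover_mul.
Proof.
case=> a c; congr pair; first by rewrite /= mulVg.
by apply/ffunP=> -[b l]; rewrite !ffunE /= invgK addbb.
Qed.

HB.instance Definition _ :=
  Finite_isGroup.Build parity_cover cover_mulA cover_mul1 cover_mulV.

Variable f : A -> P.

Definition cover_gen l : parity_cover := (f l, [ffun e => e == (1, l)]).

Lemma cover_word_vertex s w :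
  (s * word_val cover_gen w).1 = s.1 * word_val f w.
Proof.
by congr (_ * _); apply: (word_val_morph (phi := fun t : parity_cover => t.1)).
Qed.

Lemma cover_word_parity s w e :
  (s * word_val cover_gen w).2 e = s.2 e (+) odd (count_mem e (trail f s.1 w)).
Proof.
have genE (t : parity_cover) l :
    (t * cover_gen l).2 e = t.2 e (+) (e == (t.1, l)).
  rewrite !ffunE /=; case: e => b k /=; congr (_ (+) _).
  by rewrite !xpair_eqE -eq_mulVg1 eq_sym.
elim: w s => [|x w IHw] s; first by rewrite word_val_nil mulg1 addbF.
rewrite [trail _ _ _]/= [count_mem _ _]/=.
have <- : (s * letter_val cover_gen x).1 = s.1 * letter_val f x by case: x.
rewrite word_val_cons mulgA IHw oddD oddb addbA.
congr (_ (+) _); case: x => l.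
  by rewrite [letter_val _ _]/= genE eq_sym.
(* An inverse letter reduces to the positive one by writing s as (s x^-1) x. *)
rewrite [letter_val _ _]/= -[in RHS](mulgKV (cover_gen l) s) genE.
by rewrite mulgKV [X in _ (+) X]eq_sym addbK.
Qed.

End ParityCover.

(** * Odd edges between two vertices of the cover *)

Section CoverLinks.
Local Open Scope group_scope.
Variables (A : finType) (P : finGroupType) (f : A -> P).
Implicit Types (s t : parity_cover A P) (S : pred (P * A)) (e : P * A).

Definition odd_edges s t : pred (P * A) := [pred e | s.2 e (+) t.2 e].

Definition lift_edges S : pred (parity_cover A P * A) :=
  [pred e | S (e.1.1, e.2)].

Lemma lift_edges_trail S s w :
  all (lift_edges S) (trail (cover_gen f) s w) = all S (trail f s.1 w).
Proof.
elim: w s => [|x w IHw] s //.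
rewrite [trail _ _ _]/= [trail f _ _]/= [LHS]/= [RHS]/= IHw.
by case: x.
Qed.

Lemma linked_cover S s t :
  linked (cover_gen f) (lift_edges S) s t -> linked f S s.1 t.1.
Proof.
case/linkedP=> w -> Sw; apply/linkedP; exists w.
  by rewrite (cover_word_vertex f).
by rewrite -lift_edges_trail.
Qed.

(** The parities depend on s and t only, so an odd edge occurs on every walk from s to t, in
    particular on one inside S. *)
Lemma odd_edges_linked S s t e :
  linked (cover_gen f) (lift_edges S) s t -> odd_edges s t e ->
  S e /\ linked f S s.1 e.1.
Proof.
case/linkedP=> w -> Sw; rewrite lift_edges_trail in Sw.
rewrite /odd_edges /= cover_word_parity addKb => oe.
have we : e \in trail f s.1 w.
  by rewrite -has_pred1 has_count; case: count oe.
by split; [apply: (allP Sw) | apply: linked_trail we].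
Qed.

(* A walk leaving the set [D] of vertices reachable from its origin through   *)
(* odd edges would cross the boundary of [D] an odd number of times, although *)
(* it uses each boundary edge an even number of times.                        *)
Lemma linked_odd_edges s t :
  linked (cover_gen f) predT s t -> linked f (odd_edges s t) s.1 t.1.
Proof.
case/linkedP=> w tE _; set D := linked f (odd_edges s t) s.1.
pose cut e := D e.1 (+) D (e.1 * f e.2).
have cutE a u : D a (+) D (a * word_val f u) =
    odd (\sum_(e | cut e) count_mem e (trail f a u)).
  elim: u a => [|x u IHu] a.
    by rewrite word_val_nil mulg1 addbb big1.
  rewrite word_val_cons mulgA /= big_split /= oddD -IHu.
  rewrite big_mkcond (bigD1 (underlying f a x)) //= eqxx big1 => [|e /negPf].
    have -> : cut (underlying f a x) = D a (+) D (a * letter_val f x).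
      by case: x => l; rewrite /cut //= mulgKV addbC.
    rewrite addn0; case: (D a); case: (D (a * letter_val f x));
      by case: (D (_ * word_val f u)).
  by rewrite eq_sym => ->; case: ifP.
have D_s : D s.1 by apply: linked_refl.
suff : ~~ (D s.1 (+) D t.1) by rewrite D_s addTb negbK.
rewrite tE (cover_word_vertex f) cutE.
elim/big_ind: _ => // [m k /negPf om /negPf ok | e].
  by rewrite oddD om ok.
have <- : odd_edges s t e = odd (count_mem e (trail f s.1 w)).
  by rewrite /odd_edges /= tE cover_word_parity addKb.
apply: contraL => oe; rewrite /cut.
suff -> : D (e.1 * f e.2) = D e.1 by rewrite addbb.
have le := linked_edge f oe.
by apply/idP/idP => h; apply: linked_trans h _; rewrite // linked_sym.
Qed.

End CoverLinks.

(** * Lifting systems of points to the free group *)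

Section Systems.
Local Open Scope group_scope.
Variables (A : finType) (Q : finGroupType) (q : A -> Q).
Implicit Types (C : {set Q * A}) (r : free_group A).

(** The word w need not be reduced, so lifts compose by concatenation; reducing it later only drops
    edges ([trail_free_word]). *)
Definition lifts C x r y : Prop :=
  exists w, [/\ word_val (@free_gen A) w = r, x * word_val q w = y
              & {subset trail q x w <= C}].

Lemma lifts_mul C x r y (t : free_group A) z :
  lifts C x r y -> lifts C y t z -> lifts C x (r * t) z.
Proof.
case=> u [<- <- Cu] [w [<- <- Cw]]; exists (u ++ w).
split; rewrite ?word_val_cat ?mulgA // => e.
by rewrite trail_cat mem_cat => /orP[/Cu | /Cw].
Qed.

Lemma lifts_inv C x r y : lifts C x r y -> lifts C y r^-1 x.
Proof.
case=> u [<- <- Cu]; exists (word_inv u).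
split; rewrite ?word_val_inv ?mulgK // => e.
by rewrite trail_inv mem_rev => /Cu.
Qed.

Section Level.
Variables (P : finGroupType) (f : A -> P) (phi : P -> Q).

Definition pullback C : pred (P * A) := [pred e | (phi e.1, e.2) \in C].

(* The strict bound on [size links] makes level 0, that is Q itself, vacuous, *)
(* so that [solvable_cover] also accounts for the systems without links.      *)
Definition solvable m : Prop :=
  forall (W : finType) (d : P) (g : W -> P)
    (hubs : seq (W * {set Q * A})) (links : seq (W * W * {set Q * A})),
  size links < m ->
  (forall u, linked f predT d (g u)) ->
  {in hubs, forall c, linked f (pullback c.2) d (g c.1)} ->
  {in links, forall l, linked f (pullback l.2) (g l.1.1) (g l.1.2)} ->
  exists F : W -> free_group A,
    {in hubs, forall c, lifts c.2 (phi d) (F c.1) (phi (g c.1))} /\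
    {in links, forall l,
       lifts l.2 (phi (g l.1.1)) ((F l.1.1)^-1 * F l.1.2) (phi (g l.1.2))}.

Hypothesis phiM : {morph phi : a b / a * b}.
Hypothesis phif : forall a, phi (f a) = q a.

Lemma trail_morph a w :
  trail q (phi a) w = [seq (phi e.1, e.2) | e <- trail f a w].
Proof.
have phiV b l : phi (b * (f l)^-1) = phi b * (q l)^-1.
  by apply: (canRL (mulgK _)); rewrite -phif -phiM mulgKV.
elim: w a => [|l w IHw] a //=.
by case: l => l /=; rewrite -IHw ?phiV ?phiM ?phif.
Qed.

Lemma lifts_trail C a w : all (pullback C) (trail f a w) ->
  lifts C (phi a) (word_val (@free_gen A) w) (phi (a * word_val f w)).
Proof.
move=> /allP Cw; exists w.
split=> [//||e]; first by rewrite phiM (word_val_morph w phiM phif).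
by rewrite trail_morph => /mapP[e' /Cw ? ->].
Qed.

End Level.

Variables (P : finGroupType) (f : A -> P) (phi : P -> Q).
Hypothesis phiM : {morph phi : a b / a * b}.
Hypothesis phif : forall a, phi (f a) = q a.

Let psi (s : parity_cover A P) := phi s.1.

(** The hypothesis is applied to K with hub p and to the complement with hub d. Both systems have
    fewer links: [ls] turns into hub constraints, and [l0] lies in K. *)
Lemma solvable_cover m : solvable f phi m -> solvable (cover_gen f) psi m.+1.
Proof.
move=> IH W d g hubs links; rewrite ltnS => lt_m reach hubsP linksP.
have projP C s t : linked (cover_gen f) (pullback psi C) s t ->
    linked f (pullback phi C) s.1 t.1.
  exact: (@linked_cover _ _ f (pullback phi C)).
case: links lt_m linksP => [_ _ | l0 links0].
  (* Without links each point is lifted alone: the odd edges lie in every set allowed at u, so one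
     odd path meets all its hub constraints. *)
  have hubs_lift u : exists r, forall C, (u, C) \in hubs ->
      lifts C (psi d) r (psi (g u)).
    have /linkedP[w gE oddw] := linked_odd_edges (reach u).
    exists (word_val (@free_gen A) w) => C uC; rewrite /psi gE.
    apply: (lifts_trail phiM phif); apply: sub_all oddw => e.
    by case/(odd_edges_linked (S := pullback phi C) (hubsP _ uC)).
  have [F FP] := fin_all_exists hubs_lift.
  by exists F; split=> // -[u C] /FP.
set links := l0 :: links0 => lt_m linksP.
pose adj := [rel x y | has (fun l => (l.1.1 == x) && (l.1.2 == y)
                                || (l.1.1 == y) && (l.1.2 == x)) links].
pose K := [set u | connect adj l0.1.1 u].
have adjK (x y : W) : adj x y -> (x \in K) = (y \in K).
  have sub u v : adj u v -> u \in K -> v \in K.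
    by move=> uv; rewrite !inE => /connect_trans; apply; apply: connect1.
  have sym u v : adj u v -> adj v u.
    by case/hasP=> l ll lE; apply/hasP; exists l; rewrite // orbC.
  by move=> xy; apply/idP/idP; apply: sub => //; apply: sym.
have linkK l : l \in links -> (l.1.1 \in K) = (l.1.2 \in K).
  by move=> ll; apply: adjK; apply/hasP; exists l; rewrite ?eqxx.
have l0_in : l0 \in links by rewrite mem_head.
have l0K : l0.1.1 \in K by rewrite inE connect0.
pose hit v := has (fun l => (l.1.1 \in K) &&
                    linked f (pullback phi l.2) (g l.1.1).1 v) links.
have /linkedP[z zE oddz] := linked_odd_edges (reach l0.1.1).
have hit_z : hit (d.1 * word_val f z).
  by rewrite -zE; apply/hasP; exists l0; rewrite // l0K linked_refl.
have [w [hit_p wz w_hit]] := first_hit hit_z.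
set p := d.1 * word_val f w in hit_p.
(* Up to p no edge lies on a link inside K, so its parity relative to d is    *)
(* the same for all points of K.                                              *)
have w_odd u e : u \in K -> e \in trail f d.1 w -> odd_edges d (g u) e.
  move=> uK we; have := allP oddz _ (wz _ we); rewrite /odd_edges /=.
  suff -> : (g u).2 e = (g l0.1.1).2 e by [].
  pose a := [pred v | (v \in K) && ((g v).2 e == (g l0.1.1).2 e)].
  suff cl : closed adj a.
    have : u \in a; last by rewrite inE => /andP[_ /eqP].
    have l0u : connect adj l0.1.1 u by rewrite inE in uK.
    by rewrite -(closed_connect cl l0u) inE l0K eqxx.
  move=> x y xy.
  change (((x \in K) && ((g x).2 e == (g l0.1.1).2 e))
        = ((y \in K) && ((g y).2 e == (g l0.1.1).2 e))).
  rewrite (adjK _ _ xy); case yK: (y \in K) => //=.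
  suff -> : (g x).2 e = (g y).2 e by [].
  have lE l : l \in links -> l.1.1 \in K -> (g l.1.1).2 e = (g l.1.2).2 e.
    move=> ll lK; apply/eqP; apply: contraT => ne.
    have oe : odd_edges (g l.1.1) (g l.1.2) e.
      by rewrite /odd_edges /=; case: (_ e) (_ e) ne => [] [].
    have [Ce le] := odd_edges_linked (S := pullback phi l.2) (linksP _ ll) oe.
    have /negP[] := w_hit _ we.
    apply/andP; split; apply/hasP; exists l; rewrite // lK //=.
    exact: linked_trans le (linked_edge f Ce).
  case/hasP: xy yK => l ll /orP[] /andP[/eqP<- /eqP<-] lK.
    by apply: lE; rewrite ?linkK.
  by apply/esym; apply: lE.
have hubK C u : u \in K -> (u, C) \in hubs ->
    all (pullback phi C) (trail f d.1 w).
  move=> uK uC; apply/allP=> e /(w_odd _ _ uK).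
  by case/(odd_edges_linked (S := pullback phi C) (hubsP _ uC)).
case/hasP: hit_p => ls ls_in /andP[lsK ls_p].
(* As p lies on [ls], edges of P over [ls.2] join it to both ends. *)
pose hubs1 := [:: (ls.1.1, ls.2), (ls.1.2, ls.2) & [seq c <- hubs | c.1 \in K]].
pose links1 := [seq l <- rem ls links | l.1.1 \in K].
pose hubs2 := [seq c <- hubs | c.1 \notin K].
pose links2 := [seq l <- links | l.1.1 \notin K].
have size_links1 : size links1 < m.
  apply: leq_trans lt_m; rewrite ltnS.
  by rewrite size_filter (leq_trans (count_size _ _)) // size_rem.
have w_linked C u :
    u \in K -> (u, C) \in hubs -> linked f (pullback phi C) d.1 p.
  by move=> uK uC; apply/linkedP; exists w; rewrite // (hubK C u).
have [|u|c|l|F1 [F1h F1l]] := IH W p (fun u => (g u).1) hubs1 links1.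
- exact: size_links1.
- apply: (@linked_trans _ _ f predT d.1); last exact: linked_cover (reach u).
  by rewrite linked_sym; apply/linkedP; exists w; rewrite ?all_predT.
- rewrite !inE mem_filter => /or3P[/eqP->|/eqP->|/andP[cK ch]] /=.
  + by rewrite linked_sym.
  + by apply: linked_trans (projP _ _ _ (linksP _ ls_in)); rewrite linked_sym.
  + apply: linked_trans (projP _ _ _ (hubsP _ ch)).
    by rewrite linked_sym (w_linked c.2 c.1) // -surjective_pairing.
- by rewrite mem_filter => /andP[_ /mem_rem/linksP/projP].
have [|u|c|l|F2 [F2h F2l]] := IH W d.1 (fun u => (g u).1) hubs2 links2.
- apply: leq_trans lt_m; rewrite ltnS size_filter /= l0K /=.
  by rewrite count_size.
- exact: linked_cover (reach u).
- by rewrite mem_filter => /andP[_ /hubsP/projP].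
- by rewrite mem_filter => /andP[_ /linksP/projP].
pose t := word_val (@free_gen A) w.
(* The factor t leads from d to p, restoring the hub d, and cancels along links inside K. *)
exists (fun u => if u \in K then t * F1 u else F2 u); split=> [c ch | l ll].
  case: ifPn => cK; last by apply: F2h; rewrite mem_filter cK.
  apply: (@lifts_mul _ _ _ (phi p)).
    apply: (lifts_trail phiM phif); apply: (hubK _ c.1) => //.
    by rewrite -surjective_pairing.
  by apply: F1h; rewrite !inE mem_filter cK ch !orbT.
rewrite -(linkK _ ll); case: ifPn => lK; last first.
  by apply: F2l; rewrite mem_filter lK.
rewrite invMg mulgA mulgKV.
have [l_ls | ne] := eqVneq l ls.
  rewrite l_ls; apply: (@lifts_mul _ _ _ (phi p)).
    by apply: lifts_inv; apply: (F1h (ls.1.1, ls.2)); rewrite inE eqxx.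
  by apply: (F1h (ls.1.2, ls.2)); rewrite !inE eqxx orbT.
apply: F1l; rewrite mem_filter lK; move: ll.
by rewrite (perm_mem (perm_to_rem ls_in)) inE (negPf ne).
Qed.

End Systems.

(** * Free reduction and traversed edges *)

Section FreeWordTrail.
Local Open Scope group_scope.
Variables (A : finType) (P : finGroupType) (f : A -> P).

Lemma trail_push a x (u : word A) :
  {subset trail f a (push x u) <= trail f a (x :: u)}.
Proof.
case: u => [|y u] //=; case: eqP => [-> | _] e; last by [].
by rewrite letter_val_inv mulgK !inE => ->; rewrite !orbT.
Qed.

Lemma trail_free_word a (w : word A) :
  {subset trail f a (free_word (word_val (@free_gen A) w)) <= trail f a w}.
Proof.
elim: w a => [|x w IHw] a e; first by rewrite word_val_nil.
rewrite word_val_cons.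
have -> r : free_word (letter_val (@free_gen A) x * r) = push x (free_word r).
  by case: x.
move/trail_push; rewrite /= !inE => /orP[-> // | /IHw ->].
by rewrite orbT.
Qed.

End FreeWordTrail.

(** * The iterated covers of Q *)

Section Tower.
Local Open Scope group_scope.
Variables (A : finType) (Q : finGroupType) (q : A -> Q).

(** Left translation by a is injective on edges, which moves the constraint from a to the origin. *)
Lemma lifts_content C a (v : word A) (r : free_group A) :
  C = [set e | e \in trail q a v] -> lifts q C a r (a * word_val q v) ->
  word_val q v = word_val q (free_word r) /\
  content (cayley_path q (free_word r)) \subset content (cayley_path q v).
Proof.
move=> CE [w [<- /mulgI wv Cw]]; split.
  by rewrite -wv; apply: word_val_free; rewrite free_gen_generates.
apply/subsetP=> e; rewrite !mem_content => /trail_free_word we.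
have inj_a : injective (fun e : Q * A => (a * e.1, e.2)).
  by case=> ? ? [? ?] [/mulgI-> ->].
rewrite -(mem_map inj_a) -trail_translate mulg1.
have := Cw (a * e.1, e.2); rewrite CE inE; apply.
by rewrite -[X in trail _ X _]mulg1 trail_translate; apply/mapP; exists e.
Qed.

Lemma solvable_tower m : exists (P : finGroupType) (f : A -> P) (phi : P -> Q),
  [/\ {morph phi : a b / a * b}, forall l, phi (f l) = q l
    & solvable q f phi m].
Proof.
elim: m => [|m [P [f [phi [phiM phif IH]]]]]; first by exists Q, q, id.
exists (parity_cover A P), (cover_gen f), (fun s => phi s.1); split=> //.
  by move=> s t /=; rewrite phiM.
exact: solvable_cover.
Qed.

End Tower.

(** * Commuting labellings and potentials *)

Section PathValues.
Local Open Scope group_scope.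
Variables (A : finType) (E : graph) (G : groupType).
Variables (f : A -> G) (v : edge E -> word A).

Lemma is_path_cat x y z p p' :
  is_path (E := E) x p y -> is_path y p' z -> is_path x (p ++ p') z.
Proof.
elim: p x => [|e p IHp] x /=; first by move->.
by case=> -> /IHp yp /yp.
Qed.

Lemma is_path_rev x y p :
  is_path (E := E) x p y -> is_path y (rev (map (@edge_inv E) p)) x.
Proof.
elim: p x => [|e p IHp] x /=; first by move->.
case=> <- /IHp{}IHp; rewrite rev_cons -cats1; apply: is_path_cat IHp _ => /=.
by rewrite src_edge_inv tgt_edge_inv.
Qed.

Definition path_val p : G := word_val f (flatten (map v p)).

Lemma path_val_cons e p : path_val (e :: p) = word_val f (v e) * path_val p.
Proof. exact: word_val_cat. Qed.

Lemma path_val_cat p p' : path_val (p ++ p') = path_val p * path_val p'.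
Proof. by rewrite /path_val map_cat flatten_cat word_val_cat. Qed.

Lemma path_val_nil : path_val [::] = 1.
Proof. exact: word_val_nil. Qed.

Lemma path_val_rev p : word_labelling v ->
  path_val (rev (map (@edge_inv E) p)) = (path_val p)^-1.
Proof.
move=> vV; elim: p => [|e p IHp]; first by rewrite path_val_nil invg1.
rewrite [map _ _]/= rev_cons -cats1 path_val_cat IHp !path_val_cons.
by rewrite vV word_val_inv path_val_nil mulg1 invMg.
Qed.

(** Take values of chosen paths from [x0]. Being values of words, they are reachable from 1, as
    [solvable] demands of its points. *)
Lemma commuting_potential (x0 : vertex E) :
  connected E -> word_labelling v -> commutes_over f v ->
  exists g : vertex E -> G,
    [/\ forall x, exists w, g x = word_val f w
      & forall k, g (tgt k) = g (src k) * word_val f (v k)].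
Proof.
move=> conE vV vC; have [p pP] := fin_all_exists (conE x0).
exists (fun x => path_val (p x)); split=> [x|k].
  by exists (flatten (map v (p x))).
have path_k : is_path (src k) [:: k] (tgt k) by [].
have path_tgt := is_path_cat (pP (src k)) path_k.
have := is_path_cat path_tgt (is_path_rev (pP (tgt k))).
move/vC; rewrite -/(path_val _) !path_val_cat path_val_rev // path_val_cons.
by rewrite path_val_nil mulg1 => /(canRL (mulgKV _)); rewrite mul1g.
Qed.

Lemma potential_commutes (F : vertex E -> G) :
  (forall k, word_val f (v k) = (F (src k))^-1 * F (tgt k)) ->
  commutes_over f v.
Proof.
move=> vF u p pP; rewrite -/(path_val _).
suff pE x z : is_path x p z -> path_val p = (F x)^-1 * F z.
  by rewrite (pE _ _ pP) mulVg.
elim: p x {pP} => [|e p IHp] x /=.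
  by move=> ->; rewrite path_val_nil mulVg.
by case=> <- /IHp; rewrite path_val_cons vF => ->; rewrite mulgA mulgK.
Qed.

End PathValues.

(** * Passing to the subgroup generated by A, as [cover_gen f] need not generate the cover *)

Section GeneratedSubgroup.
Local Open Scope group_scope.
Variables (A : finType) (P : finGroupType) (f : A -> P).

Definition generated_subgroup := <<(f @: [set: A])%SET>>%G.

Lemma mem_generated l : f l \in generated_subgroup.
Proof. by rewrite mem_gen // imset_f. Qed.

Definition subgroup_gen l : subg_of generated_subgroup :=
  Subg (mem_generated l).

Lemma subgroup_gen_generates : generates subgroup_gen.
Proof.
apply/eqP; rewrite eqEsubset subsetT /=; set H := <<_>>.
have sub : generated_subgroup \subset sgval @* H.
  rewrite gen_subG; apply/subsetP=> _ /imsetP[l _ ->].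
  rewrite -[f l]/(sgval (subgroup_gen l)) mem_morphim ?inE //.
  by rewrite mem_gen // imset_f.
apply/subsetP=> x _; have /morphimP[y _ yH xy] := subsetP sub _ (valP x).
by rewrite (val_inj xy).
Qed.

Lemma expands_subgroup_gen (Q : finGroupType) (q : A -> Q) (phi : P -> Q) :
  {morph phi : a b / a * b} -> (forall l, phi (f l) = q l) ->
  expands subgroup_gen q.
Proof.
move=> phiM phif.
have morph : {in [set: subg_of generated_subgroup] &,
    {morph phi \o sgval : a b / a * b}} by move=> a b _ _ /=; rewrite phiM.
by exists (Morphism morph).
Qed.

Lemma sgval_word_val w : sgval (word_val subgroup_gen w) = word_val f w.
Proof. exact: word_val_morph. Qed.

End GeneratedSubgroup.

Theorem proposition5p2 (A : finType) (A_nonempty : 0 < #|A|)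
    (Q : finGroupType) (q : A -> Q) (Q_gen : generates q)
    (n : nat) (n_gt0 : 0 < n) :
  exists (H : finGroupType) (h : A -> H),
    [/\ generates h,
        expands h q &
        forall (E : graph), connected E -> #|vertex E| <= n ->
        forall v : edge E -> word A,
          word_labelling v -> commutes_over h v ->
        exists w : edge E -> word A,
          [/\ word_labelling w,
              commutes_over (@free_gen A) w &
              forall k : edge E,
                word_val q (v k) = word_val q (w k) /\
                content (cayley_path q (w k))
                  \subset content (cayley_path q (v k))]].
Proof.
(* The number of triples (source, target, edge set in Q), plus one because [solvable] bounds
   strictly. *)
set m := (n * n * #|{: {set Q * A}}|).+1.
have [P [f [phi [phiM phif solv]]]] := solvable_tower q m.
exists (subg_of (generated_subgroup f)), (subgroup_gen f).
split; [exact: subgroup_gen_generates | exact: expands_subgroup_gen | ].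
move=> E conE leE v vV vC.
have vCf : commutes_over f v.
  by move=> u p /vC vp; rewrite -sgval_word_val vp.
case: (pickP (vertex E)) => [x0 _ | E0]; last first.
  exists v; split=> [//|x|k]; first by have := E0 x.
  by have := E0 (src k).
have [g [gW gk]] := commuting_potential x0 conE vV vCf.
pose C k := [set e | e \in trail q (phi (g (src k))) (v k)].
(* Enumerating a set merges repeated links, so the number of edges of E does not enter the bound. *)
pose links := enum [set l | [exists k, l == (src k, tgt k, C k)]].
have size_links : size links < m.
  rewrite ltnS -cardE (leq_trans (max_card _)) // !card_prod.
  by rewrite leq_mul // leq_mul.
have [u|c|l|F [_ FP]] := solv _ 1%g g [::] links size_links.
- have [w ->] := gW u; apply/linkedP; exists w; first by rewrite mul1g.
  exact: all_predT.
- by [].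
- rewrite mem_enum inE => /existsP[k /eqP->] /=.
  apply/linkedP; exists (v k); rewrite ?gk //; apply/allP=> e ek.
  by rewrite /pullback /= inE (trail_morph phiM phif); apply/mapP; exists e.
pose r k := ((F (src k))^-1 * F (tgt k))%g.
exists (fun k => free_word (r k)); split.
- move=> k; rewrite /r src_edge_inv tgt_edge_inv.
  (* Inversion in [free_group] is [word_inv] on reduced words, by definition. *)
  rewrite -[word_inv _]/(free_word (_^-1)%g).
  by rewrite invMg invgK.
- apply: (@potential_commutes _ _ _ _ _ F) => k.
  exact: free_gen_generates.
- move=> k; apply: (lifts_content (C := C k)) => //.
  have := FP (src k, tgt k, C k); rewrite mem_enum inE /= gk phiM.
  rewrite (word_val_morph _ phiM phif); apply.
  by apply/existsP; exists k.
Qed.
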